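(* Let $b\geq2$, $n\geq2$, $\alpha_1,\dots,\alpha_n>0$, $y_1=0$ and let $y_2,\dots,y_n\in[0,1)$ be $b$-adic rational numbers. Then the multivariate multifractal Legendre spectrum, based on second-order oscillations, of $L_{\alpha_1}^{b,-y_1},\dots,L_{\alpha_n}^{b,-y_n}$ is $$\mathcal{L}(H_1,\dots,H_n)=\begin{cases}\frac{H_1}{\alpha_1}, & \text{if } (H_1,\dots,H_n)\in[0,\alpha_1]\times\cdots\times[0,\alpha_n] \text{ and } H_i=\frac{\alpha_i}{\alpha_1}H_1 \text{ for all } 2\le i\le n,\\ -\infty, & \text{otherwise.}\end{cases}$$
   Context: Fix an integer $b\geq 2$. The saw-tooth function is $\{x\}=x-\lfloor x\rfloor-\frac12$ if $x\notin\mathbb{Z}$ and $\{x\}=0$ if $x\in\mathbb{Z}$. For $\alpha>0$ the Lévy function is $L_\alpha^b(x)=\sum_{i\geq1}\{b^ix\}\,b^{-\alpha i}$, and for $y\in\mathbb{R}$ the shifted Lévy function is $L_\alpha^{b,y}(x)=L_\alpha^b(x-y)$ (so $L_\alpha^{b,-y}(x)=L_\alpha^b(x+y)$). $b$-adic grid: for $j\in\mathbb{N}$, $k\in\mathbb{Z}$, $\lambda=\lambda(j,k)=[kb^{-j},(k+1)b^{-j})$ and $3\lambda=[(k-1)b^{-j},(k+2)b^{-j})$. $\Lambda_j$ denotes the set of the $b^j$ such intervals of width $b^{-j}$ contained in $[0,1)$. Second-order difference: $\Delta_f^2(x,h)=f(x+2h)-2f(x+h)+f(x)$. The oscillation of $f$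 on $3\lambda$ is $d_\lambda(f)=\sup\{|\Delta_f^2(x,h)|:\ x,\,x+2h\in3\lambda\}$. For functions $f_1,\dots,f_d$ with $d_\lambda^{(i)}=d_\lambda(f_i)$: structure function $S(r,j)=b^{-j}\sum_{\lambda\in\Lambda_j}\prod_{i=1}^d (d_\lambda^{(i)})^{r_i}$ for $r\in\mathbb{R}^d$; scaling function $\zeta(r)=\liminf_{j\to\infty}\frac{\log S(r,j)}{\log b^{-j}}$; multivariate multifractal Legendre spectrum $\mathcal{L}_{f_1,\dots,f_d}(H)=\inf_{r\in\mathbb{R}^d}\big(1-\zeta(r)+H\cdot r\big)$ for $H\in\mathbb{R}^d$ (value $-\infty$ allowed). *)

(* Defs.v *)
From HB Require Import structures.
From mathcomp Require Import all_boot all_order all_algebra.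
From mathcomp Require Import all_classical all_reals all_analysis.
Set Implicit Arguments. Unset Strict Implicit. Unset Printing Implicit Defensive.
Import Order.TTheory GRing.Theory Num.Theory.
Local Open Scope ring_scope.
Local Open Scope classical_set_scope.

Section Defs.
Variable R : realType.

Definition sawtooth (x : R) : R :=
  if (Num.floor x)%:~R == x then 0 else x - (Num.floor x)%:~R - 2^-1.

Definition levy (b : nat) (alpha : R) (x : R) : R :=
  limn (fun N : nat =>
    \sum_(1 <= i < N) (sawtooth ((b%:R) ^+ i * x) * powR (b%:R) (- (alpha * i%:R)))).

Definition shifted_levy (b : nat) (alpha y : R) (x : R) : R := levy b alpha (x - y).

Definition Delta2 (f : R -> R) (x h : R) : R := f (x + 2 * h) - 2 * f (x + h) + f x.

Definition in3lambda (b j : nat) (k : int) (x : R) : bool :=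
  ((k - 1)%:~R * (b%:R ^- j) <= x) && (x < (k + 2)%:~R * (b%:R ^- j)).

Definition osc (b : nat) (f : R -> R) (j : nat) (k : int) : R :=
  sup [set v : R | exists x h : R,
         [/\ in3lambda b j k x, in3lambda b j k (x + 2 * h) & v = `|Delta2 f x h|] ].

Definition structure_fun (b d : nat) (f : 'I_d -> R -> R) (r : 'I_d -> R) (j : nat) : R :=
  (b%:R ^- j) * \sum_(k < b ^ j) \prod_(i < d) powR (osc b (f i) j k%:Z) (r i).

Definition scaling_fun (b d : nat) (f : 'I_d -> R -> R) (r : 'I_d -> R) : \bar R :=
  limn_einf (fun j : nat => ((ln (structure_fun b f r j) / ln (b%:R ^- j)))%:E).

Definition legendre_spectrum (b d : nat) (f : 'I_d -> R -> R) (H : 'I_d -> R) : \bar R :=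
  ereal_inf [set (1%:E - scaling_fun b f r + (\sum_(i < d) H i * r i)%:E)%E
            | r in [set: 'I_d -> R]].

Definition badic_in01 (b : nat) (y : R) : Prop :=
  exists (j k : nat), y = k%:R / (b%:R ^+ j) /\ 0 <= y /\ y < 1.

End Defs.

(* Main.v *)
(** Let [l(k)] be the least [l] such that one of [k-1, k, k+1] is divisible by [b^(j-l)].  On [3 lambda(j,k)] the terms of index [< l(k)] of the Lévy series are affine, so second differences do not see them, while the term of index [l(k)] has a jump there; hence the oscillation is of order [b^(-alpha l(k))].  Shifting by a [b]-adic rational changes only the levels below some fixed [J], hence costs only constants, and all the oscillations are governed by the same [l(k)].  At most [3 b^l] of the [b^j] intervals have level [<= l], and a positive proportion has level [>= j-1], so with [s = sum alpha_i r_i] the structure function is of order [b^(-j min(1,s))] up to a factor [j+1], i.e. [zeta(r) = min(1,s)].  The spectrum is then the infimum of [max(0, 1-s) + H.r]. *)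
Require Import Defs.
From HB Require Import structures.
From mathcomp Require Import all_boot all_order all_algebra.
From mathcomp Require Import all_classical all_reals all_analysis.
From mathcomp Require Import ring lra zify.
Import Order.TTheory GRing.Theory Num.Theory.
Import numFieldNormedType.Exports.
Local Open Scope ring_scope.

(** * Second differences of the saw-tooth function *)

Lemma sawtooth_int (R : realType) (m : int) : sawtooth m%:~R = 0 :> R.
Proof. by rewrite /sawtooth intrKfloor eqxx. Qed.

Lemma sawtoothE (R : realType) (m : int) (x : R) :
  m%:~R < x < (m + 1)%:~R -> sawtooth x = x - m%:~R - 2^-1.
Proof.
move=> /andP[mx xm]; rewrite /sawtooth.
have -> : Num.floor x = m by apply: floor_def; rewrite (ltW mx).
by rewrite lt_eqF.
Qed.

Lemma sawtooth_bound (R : realType) (x : R) : `|sawtooth x| <= 2^-1.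
Proof.
rewrite /sawtooth; case: ifP => _; first by rewrite normr0; lra.
have /andP[] := floor_itv x; rewrite intrD => h1 h2.
by rewrite ler_norml; lra.
Qed.

(** The midpoint [x + h] lies between the two end points, hence on the same affine piece. *)
Lemma Delta2_sawtooth_affine (R : realType) (m : int) (x h : R) :
  m%:~R < x < (m + 1)%:~R -> m%:~R < x + 2 * h < (m + 1)%:~R ->
  Delta2 (@sawtooth R) x h = 0.
Proof.
move=> h1 h2; rewrite /Delta2 (sawtoothE _ _ _ h1) (sawtoothE _ _ _ h2).
rewrite (sawtoothE _ m); first by lra.
by move: h1 h2; rewrite intrD; lra.
Qed.

(** The value at [m] is 0 and not the right limit [-1/2], which leaves a defect of [1/2]; [h < 1/2]
    keeps [m + 2h] before the next integer. *)
Lemma Delta2_sawtooth_jump (R : realType) (m : int) (h : R) :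
  0 < h -> h < 2^-1 -> Delta2 (@sawtooth R) m%:~R h = 2^-1.
Proof.
move=> h0 h1; rewrite /Delta2 sawtooth_int !(sawtoothE _ m) ?intrD; lra.
Qed.

Lemma Delta2_sawtooth_int_half (R : realType) (m : int) :
  Delta2 (@sawtooth R) m%:~R 2^-1 = 0.
Proof.
rewrite /Delta2 sawtooth_int.
have -> : m%:~R + 2 * 2^-1 = (m + 1)%:~R :> R by rewrite intrD; lra.
by rewrite sawtooth_int (sawtoothE _ m) ?intrD; lra.
Qed.

Lemma Delta2_sawtooth_int (R : realType) (m p : int) :
  Delta2 (@sawtooth R) m%:~R p%:~R = 0.
Proof.
by rewrite /Delta2 -(intrM _ 2) -!intrD !sawtooth_int; lra.
Qed.

Lemma Delta2_sawtooth_bound (R : realType) (x h : R) :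
  `|Delta2 (@sawtooth R) x h| <= 2.
Proof.
rewrite /Delta2; move: (sawtooth_bound _ x) (sawtooth_bound _ (x + h)).
by move: (sawtooth_bound _ (x + 2 * h)); rewrite !ler_norml; lra.
Qed.

(** * Second differences of the Lévy series, term by term *)

Section Levy.
Context (R : realType) (b : nat) (alpha : R).
Hypotheses (hb : (2 <= b)%N) (alpha0 : 0 < alpha).

Let q : R := powR b%:R (- alpha).

Lemma powRN_base_gt0 : 0 < q.
Proof. by rewrite powR_gt0// ltr0n; lia. Qed.

Lemma powRN_base_lt1 : q < 1.
Proof.
rewrite /q /powR pnatr_eq0 (gtn_eqF (ltnW hb)) expR_lt1 mulNr oppr_lt0.
by rewrite mulr_gt0// ln_gt0// ltr1n.
Qed.

Lemma powRN_baseX (i : nat) : powR b%:R (- (alpha * i%:R)) = q ^+ i.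
Proof. by rewrite /q -powR_mulrn ?powR_ge0// -powRrM mulNr. Qed.

Lemma levyE (x : R) : levy b alpha x =
  limn (fun N => \sum_(1 <= i < N) sawtooth (b%:R ^+ i * x) * q ^+ i).
Proof.
rewrite /levy; congr (limn _); apply/funext => N.
by apply: eq_bigr => i _; rewrite powRN_baseX.
Qed.

Lemma is_cvg_levy (x : R) :
  cvgn (fun N => \sum_(1 <= i < N) sawtooth (b%:R ^+ i * x) * q ^+ i).
Proof.
rewrite (is_cvg_series_restrict 1 (fun i => sawtooth (b%:R ^+ i * x) * q ^+ i)).
have q0 := ltW powRN_base_gt0.
apply: normed_cvg; apply: (@series_le_cvg _ _ (geometric 2^-1 q)) => //=.
- by move=> i; rewrite mulr_ge0// exprn_ge0.
- move=> i; rewrite normrM (ger0_norm (exprn_ge0 _ q0)).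
  by rewrite ler_wpM2r// ?exprn_ge0// sawtooth_bound.
- by apply: is_cvg_geometric_series; rewrite ger0_norm ?powRN_base_lt1.
Qed.

Lemma cvg_Delta2_levy (x h : R) :
  ((fun N => \sum_(1 <= i < N)
      Delta2 (@sawtooth R) (b%:R ^+ i * x) (b%:R ^+ i * h) * q ^+ i) @ \oo -->
    Delta2 (levy b alpha) x h)%classic.
Proof.
rewrite /Delta2 !levyE.
set u := fun z N => \sum_(1 <= i < N) sawtooth (b%:R ^+ i * z) * q ^+ i : R.
rewrite [X in (X @ _ --> _)%classic](_ : _ =
  (fun N => u (x + 2 * h) N - 2 * u (x + h) N + u x N)); last first.
  apply/funext => N; rewrite /u mulr_sumr -sumrB -big_split/=.
  apply: eq_bigr => i _; rewrite !mulrDr (mulrCA _ 2); ring.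
apply: cvgD; last exact: is_cvg_levy.
apply: cvgB; first exact: is_cvg_levy.
by apply: cvgMl_tmp; exact: is_cvg_levy.
Qed.

(** Only the tail from [l] on survives; each saw-tooth difference in it is at most 2, and the
    geometric series is summed. *)
Lemma Delta2_levy_le (x h : R) (l : nat) : (0 < l)%N ->
  (forall i, (0 < i < l)%N ->
     Delta2 (@sawtooth R) (b%:R ^+ i * x) (b%:R ^+ i * h) = 0) ->
  `|Delta2 (levy b alpha) x h| <= 2 / (1 - q) * q ^+ l.
Proof.
move=> l0 hl; have q0 := ltW powRN_base_gt0; have q1 := powRN_base_lt1.
have /(_ _) cv := cvg_norm (cvg_Delta2_levy x h).
rewrite -(cvg_lim (@Rhausdorff R) cv); apply: limr_le.
  by apply/cvg_ex; eexists; exact: cv.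
near=> N.
have lN : (l <= N)%N by near: N; exact: nbhs_infty_ge.
rewrite (big_cat_nat l0 lN)/= big_nat_cond big1 ?add0r; last first.
  by by move=> i /andP[il _]; rewrite hl// mul0r.
apply: (le_trans (ler_norm_sum _ _ _)).
apply: (@le_trans _ _ (\sum_(l <= i < N) 2 * q ^+ i)).
  apply: ler_sum => i _; rewrite normrM (ger0_norm (exprn_ge0 _ q0)).
  by rewrite ler_wpM2r// ?exprn_ge0// Delta2_sawtooth_bound.
rewrite -mulr_sumr -(subnKC lN) geometric_partial_tail geometric_seriesE ?lt_eqF//=.
rewrite -[leRHS]mulrA [_^-1 * _]mulrC ler_wpM2l// ler_wpM2r ?invr_ge0 ?subr_ge0 ?(ltW q1)//.
have h1 : 0 <= q ^+ l by apply: exprn_ge0.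
have h2 : 0 <= q ^+ (N - l) by apply: exprn_ge0.
by nra.
Unshelve. all: by end_near. Qed.

(** With no negative terms there is no cancellation, so the [l]-th term alone bounds the sum from
    below. *)
Lemma Delta2_levy_ge (x h : R) (l : nat) : (0 < l)%N ->
  (forall i, 0 <= Delta2 (@sawtooth R) (b%:R ^+ i * x) (b%:R ^+ i * h)) ->
  Delta2 (@sawtooth R) (b%:R ^+ l * x) (b%:R ^+ l * h) = 2^-1 ->
  2^-1 * q ^+ l <= Delta2 (levy b alpha) x h.
Proof.
move=> l0 h0 hl; have q0 := ltW powRN_base_gt0.
have cv := cvg_Delta2_levy x h.
rewrite -(cvg_lim (@Rhausdorff R) cv); apply: limr_ge.
  by apply/cvg_ex; eexists; exact: cv.
near=> N.
have lN : (l < N)%N by near: N; exact: nbhs_infty_gt.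
rewrite (big_cat_nat l0 (ltnW lN))/= (big_ltn lN) hl.
rewrite addrCA lerDl addr_ge0// sumr_ge0// => i _;
  by rewrite mulr_ge0// exprn_ge0.
Unshelve. all: by end_near. Qed.

End Levy.

(** * Oscillations as suprema, and their behaviour under grid shifts *)

Section Oscillation.
Context (R : realType) (b : nat).

Lemma osc_le (f : R -> R) (j : nat) (K : int) (B : R) : (0 < b)%N ->
  (forall x h, in3lambda b j K x -> in3lambda b j K (x + 2 * h) ->
    `|Delta2 f x h| <= B) ->
  osc b f j K <= B.
Proof.
move=> b0 hB; apply: ge_sup; last by move=> _ [x [h [h1 h2 ->]]]; exact: hB.
(* The left end with [h = 0] shows that the supremum is over a nonempty set. *)
have hK : in3lambda b j K ((K - 1)%:~R * (b%:R ^- j) : R).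
  rewrite /in3lambda lexx/= ltr_pM2r ?invr_gt0 ?exprn_gt0 ?ltr0n//.
  by rewrite ltr_int; lia.
by eexists; exists ((K - 1)%:~R * b%:R ^- j), 0; split; rewrite ?mulr0 ?addr0.
Qed.

(** The bound [B] does not appear in the conclusion: it guarantees that [sup] is a true supremum and
    not its default value. *)
Lemma osc_ge (f : R -> R) (j : nat) (K : int) (B x h : R) :
  (forall x h, in3lambda b j K x -> in3lambda b j K (x + 2 * h) ->
    `|Delta2 f x h| <= B) ->
  in3lambda b j K x -> in3lambda b j K (x + 2 * h) ->
  `|Delta2 f x h| <= osc b f j K.
Proof.
move=> hB hx hxh; apply: ub_le_sup; last by exists x, h.
by exists B => _ [x' [h' [h1 h2 ->]]]; exact: hB.
Qed.

Lemma in3lambda_shift (j : nat) (K Y : int) (x : R) : (0 < b)%N ->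
  in3lambda b j (K + Y) (x + Y%:~R / b%:R ^+ j) = in3lambda b j K x.
Proof.
move=> b0; rewrite /in3lambda.
have -> : K + Y - 1 = K - 1 + Y by lia.
have -> : K + Y + 2 = K + 2 + Y by lia.
by rewrite (intrD _ (K - 1)) (intrD _ (K + 2)) !mulrDl lerD2r ltrD2r.
Qed.

Lemma osc_shift (f : R -> R) (j : nat) (K Y : int) : (0 < b)%N ->
  osc b (fun x => f (x + Y%:~R / b%:R ^+ j)) j K = osc b f j (K + Y).
Proof.
move=> b0; congr sup; apply/seteqP; split => v /= [x [h [h1 h2 ->]]].
  exists (x + Y%:~R / b%:R ^+ j), h; split.
  - by rewrite in3lambda_shift.
  - by rewrite addrAC in3lambda_shift.
  - by rewrite /Delta2; congr (`| f _ - 2 * f _ + _|); ring.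
exists (x - Y%:~R / b%:R ^+ j), h; split.
- by rewrite -(in3lambda_shift _ _ Y)// subrK.
- by rewrite -(in3lambda_shift _ _ Y)// addrAC subrK.
- by rewrite /Delta2; congr (`| f _ - 2 * f _ + f _|); ring.
Qed.

End Oscillation.

(** * Jumps of the rescaled saw-tooth inside a tripled interval *)

(** This says that [[K-1, K+2)] contains a multiple of [q]; [K + 2] is absent because the right end
    is open. With [q = b^(j-i)], it says that the [i]-th term of the series has a jump on
    [3 lambda(j,K)]. *)
Definition near_multiple (q : nat) (K : int) : bool :=
  [|| (q %| K - 1)%Z, (q %| K)%Z | (q %| K + 1)%Z].

(** The remainder of [K - 1] modulo [q] avoids [0], [q-1] and [q-2], so the whole interval fits
    strictly between consecutive multiples of [q], up to its open right end. *)
Lemma not_near_multiple_itv (R : realType) (q : nat) (K : int) : (0 < q)%N ->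
  ~~ near_multiple q K ->
  exists m : int, forall w : R, (K - 1)%:~R <= w < (K + 2)%:~R ->
    m%:~R < w / q%:R < (m + 1)%:~R.
Proof.
move=> q0 /norP[n1 /norP[n2 n3]].
pose m := ((K - 1) %/ q)%Z; pose r := ((K - 1) %% q)%Z.
have e : K - 1 = m * q%:Z + r by exact: divz_eq.
have r0 : 0 <= r by rewrite modz_ge0//; lia.
have rq : r < q%:Z by rewrite ltz_pmod.
have r1 : r != 0.
  by apply: contra n1 => /eqP r1; apply/dvdzP; exists m; rewrite e r1 addr0.
have r2 : r != q%:Z - 1.
  by apply: contra n2 => /eqP r2; apply/dvdzP; exists (m + 1); lia.
have r3 : r != q%:Z - 2.
  by apply: contra n3 => /eqP r3; apply/dvdzP; exists (m + 1); lia.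
have h1 : m * q%:Z < K - 1 by lia.
have h2 : K + 2 <= (m + 1) * q%:Z by lia.
exists m => w /andP[w1 w2].
have qR : 0 < q%:R :> R by rewrite ltr0n.
rewrite ltr_pdivlMr// ltr_pdivrMr//; apply/andP; split.
  by apply: lt_le_trans w1; rewrite -[q%:R]/(q%:Z%:~R) -intrM ltr_int.
by apply: (lt_le_trans w2); rewrite -[q%:R]/(q%:Z%:~R) -intrM ler_int.
Qed.

Lemma expr_base_div (R : realType) (b i j : nat) (w : R) : (0 < b)%N -> (i <= j)%N ->
  b%:R ^+ i * (w / b%:R ^+ j) = w / (b ^ (j - i))%:R.
Proof.
move=> b0 ij; have bn : b%:R != 0 :> R by rewrite pnatr_eq0 -lt0n.
have -> : b%:R ^+ j = b%:R ^+ (j - i) * b%:R ^+ i :> R by rewrite -exprD subnK.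
by rewrite natrX invfM mulrCA (mulrCA _ _^-1) divff ?mulr1// expf_neq0.
Qed.

Lemma Delta2_sawtooth_dvd (R : realType) (t : nat) (K : int) (h : R) :
  (0 < t)%N -> (t %| K)%Z -> 0 < h -> h < 2^-1 ->
  Delta2 (@sawtooth R) (K%:~R / t%:R) h = 2^-1.
Proof.
move=> t0 /dvdzP[m ->] h0 h1; rewrite intrM mulfK ?pnatr_eq0 -?lt0n//.
exact: Delta2_sawtooth_jump.
Qed.

(** A non-integer fraction of denominator [t] is at least [1/t] below the next integer, so both end
    points share one affine piece. *)
Lemma Delta2_sawtooth_ndvd (R : realType) (t : nat) (K : int) (h : R) :
  (0 < t)%N -> ~~ (t %| K)%Z -> 0 < h -> 2 * h < t%:R^-1 ->
  Delta2 (@sawtooth R) (K%:~R / t%:R) h = 0.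
Proof.
move=> t0 ntK h0 ht; have tR : 0 < t%:R :> R by rewrite ltr0n.
pose m := (K %/ t)%Z; pose r := (K %% t)%Z.
have e : K = m * t%:Z + r by exact: divz_eq.
have r0 : 0 <= r by rewrite modz_ge0//; lia.
have rt : r < t%:Z by rewrite ltz_pmod.
have r1 : r != 0.
  by apply: contra ntK => /eqP r1; apply/dvdzP; exists m; rewrite e r1 addr0.
have h1 : m%:~R < K%:~R / t%:R :> R.
  by rewrite ltr_pdivlMr// -[t%:R]/(t%:Z%:~R) -intrM ltr_int; lia.
have h2 : K%:~R / t%:R + t%:R^-1 <= (m + 1)%:~R :> R.
  rewrite -{2}(mul1r t%:R^-1) -mulrDl ler_pdivrMr//.
  by rewrite -[t%:R]/(t%:Z%:~R) -[1]/(1%:~R) -intrD -intrM ler_int; lia.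
apply: (Delta2_sawtooth_affine _ m); rewrite ?h1/=; lra.
Qed.

(** * Two-sided bounds for the oscillation of the Lévy function *)

Section LevyOscillation.
Context (R : realType) (b : nat) (alpha : R).
Hypotheses (hb : (2 <= b)%N) (alpha0 : 0 < alpha).

Let q : R := powR b%:R (- alpha).

Lemma Delta2_levy_le_near (j l : nat) (K : int) (x h : R) :
  (0 < l)%N -> (l <= j)%N ->
  (forall i, (0 < i < l)%N -> ~~ near_multiple (b ^ (j - i)) K) ->
  in3lambda b j K x -> in3lambda b j K (x + 2 * h) ->
  `|Delta2 (levy b alpha) x h| <= 2 / (1 - q) * q ^+ l.
Proof.
move=> l0 lj hl hx hxh; have b0 : (0 < b)%N by lia.
apply: Delta2_levy_le => // i il; have ij : (i <= j)%N by move: il => /andP[_ /ltnW/leq_trans]; exact.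
have [|m hm] := not_near_multiple_itv R _ _ _ (hl i il); first by rewrite expn_gt0 b0.
have bj : 0 < b%:R ^+ j :> R by rewrite exprn_gt0// ltr0n.
have H (z : R) : in3lambda b j K z -> m%:~R < b%:R ^+ i * z < (m + 1)%:~R.
  move=> hz; have -> : b%:R ^+ i * z = z * b%:R ^+ j / (b ^ (j - i))%:R.
    by rewrite -expr_base_div// mulfK// gt_eqF.
  by apply: hm; rewrite -ler_pdivrMr// -ltr_pdivlMr.
apply: (Delta2_sawtooth_affine _ m); first exact: H.
by rewrite mulrCA -mulrDr; exact: H.
Qed.

Lemma osc_levy_le (j l : nat) (K : int) : (0 < l)%N -> (l <= j)%N ->
  (forall i, (0 < i < l)%N -> ~~ near_multiple (b ^ (j - i)) K) ->
  osc b (levy b alpha) j K <= 2 / (1 - q) * q ^+ l.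
Proof.
move=> l0 lj hl; apply: osc_le; first by lia.
by move=> x h; exact: Delta2_levy_le_near.
Qed.

(* The witness is [x = K' b^-j], [h = b^-(j+2)]: every term of the series then has a nonnegative second difference, and the [l]-th one sees the jump at [x]. *)
Lemma Delta2_sawtooth_grid_ge0 (i j : nat) (K : int) :
  0 <= Delta2 (@sawtooth R) (b%:R ^+ i * (K%:~R / b%:R ^+ j))
                            (b%:R ^+ i * (1 / b%:R ^+ (j + 2))).
Proof.
have b0 : (0 < b)%N by lia.
have bR : 0 < b%:R :> R by rewrite ltr0n.
have b2 : 2 <= b%:R :> R by rewrite ler_nat.
have [ij|ji] := leqP i j.
  rewrite !expr_base_div//; last by lia.
  have t0 : (0 < b ^ (j - i))%N by rewrite expn_gt0 b0.
  have tR : 1 <= (b ^ (j - i))%:R :> R by rewrite ler1n.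
  (* The step is the grid spacing divided by [b^2 >= 4], which is small enough both at an integer
     (jump) and away from one (affine). *)
  have e : (b ^ (j + 2 - i))%:R = (b ^ (j - i))%:R * (b%:R * b%:R) :> R.
    by rewrite -!natrM -[(b * b)%N]/(b ^ 2)%N -expnD; congr (b ^ _)%:R; lia.
  have [tK|tK] := boolP ((b ^ (j - i))%N %| K)%Z.
    rewrite Delta2_sawtooth_dvd// ?invr_ge0// ?divr_gt0 ?ltr0n ?expn_gt0 ?b0//.
    by rewrite e mul1r ltf_pV2 ?posrE; nra.
  rewrite Delta2_sawtooth_ndvd// ?divr_gt0 ?ltr0n ?expn_gt0 ?b0//.
  rewrite e mul1r ltr_pdivrMr; last by nra.
  by rewrite mulKf ?gt_eqF; nra.
have -> : b%:R ^+ i * (K%:~R / b%:R ^+ j) = (K * (b ^ (i - j))%:Z)%:~R :> R.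
  rewrite intrM -[_%:Z%:~R]/((b ^ (i - j))%:R) natrX -{1}(subnK (ltnW ji)) exprD.
  by rewrite mulrCA -mulrA divff ?mulr1// expf_neq0// gt_eqF.
(* At index [j + 1] the rescaled step is [1/b]: a jump if [b >= 3], but exactly [1/2] if [b = 2],
   where [x + 2h] lands on the next integer. Beyond that index the step is itself an integer. *)
have [e|ne] := eqVneq i (j + 1)%N.
  have -> : b%:R ^+ i * (1 / b%:R ^+ (j + 2)) = b%:R^-1 :> R.
    by rewrite expr_base_div ?e//; [rewrite mul1r; congr ((_)%:R^-1); rewrite -[RHS]expn1; congr (_ ^ _)%N; lia|lia].
  have [->|b3] := eqVneq b 2%N; first by rewrite Delta2_sawtooth_int_half.
  rewrite Delta2_sawtooth_jump ?invr_ge0 ?invr_gt0// ltf_pV2 ?posrE//.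
  by rewrite ltr_nat; lia.
have -> : b%:R ^+ i * (1 / b%:R ^+ (j + 2)) = (b ^ (i - (j + 2)))%:Z%:~R :> R.
  have ji2 : (j + 2 <= i)%N by lia.
  rewrite -[RHS]/((b ^ (i - (j + 2)))%:R) natrX -{1}(subnK ji2) exprD.
  by rewrite mul1r mulfK// expf_neq0// gt_eqF.
by rewrite Delta2_sawtooth_int.
Qed.

Lemma osc_levy_ge (j l : nat) (K : int) : (0 < l)%N -> (l <= j)%N ->
  near_multiple (b ^ (j - l)) K ->
  2^-1 * q ^+ l <= osc b (levy b alpha) j K.
Proof.
move=> l0 lj hl; have b0 : (0 < b)%N by lia.
have lj2 : (l <= j + 2)%N by lia.
have jl2 : (2 <= j + 2 - l)%N by lia.
have bR : 0 < b%:R :> R by rewrite ltr0n.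
have b2 : 2 <= b%:R :> R by rewrite ler_nat.
have bj : 0 < b%:R ^+ j :> R by rewrite exprn_gt0.
have [K' [K1 K2 dK]] : exists K' : int,
    [/\ K - 1 <= K', K' <= K + 1 & ((b ^ (j - l))%N %| K')%Z].
  by case/or3P: hl => ?; [exists (K - 1)|exists K|exists (K + 1)]; split => //; lia.
pose x : R := K'%:~R / b%:R ^+ j; pose h : R := 1 / b%:R ^+ (j + 2).
have h0 : 0 < h by rewrite divr_gt0// exprn_gt0.
(* Since [K'] may be [K + 1], [2h] must stay below one grid width for [x + 2h] to remain in the
   tripled interval. *)
have h1 : 2 * h < (b%:R ^+ j)^-1.
  rewrite /h exprD mul1r invfM mulrCA -[ltRHS]mulr1 ltr_pM2l ?invr_gt0//.
  by rewrite ltr_pdivrMr ?mul1r expr2; nra.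
have x1 : (K - 1)%:~R * b%:R ^- j <= x.
  by rewrite /x ler_pM2r ?invr_gt0// ler_int.
have x2 : x + (b%:R ^+ j)^-1 <= (K + 2)%:~R * b%:R ^- j.
  rewrite /x -{2}(mul1r (b%:R ^+ j)^-1) -mulrDl ler_pM2r ?invr_gt0//.
  by rewrite -[1]/(1%:~R) -intrD ler_int; lia.
have B0 : 0 < (b%:R ^+ j)^-1 :> R by rewrite invr_gt0.
apply: (@le_trans _ _ `|Delta2 (levy b alpha) x h|).
  apply: le_trans (ler_norm _); apply: Delta2_levy_ge => //.
    by move=> i; exact: Delta2_sawtooth_grid_ge0.
  rewrite /x /h (expr_base_div _ _ _ _ _ b0 lj) (expr_base_div _ _ _ _ _ b0 lj2).
  apply: Delta2_sawtooth_dvd => //; rewrite ?expn_gt0 ?b0// ?divr_gt0 ?ltr0n ?expn_gt0 ?b0//.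
  rewrite mul1r ltf_pV2 ?posrE ?ltr0n ?expn_gt0 ?b0// ltr_nat.
  by rewrite (leq_trans _ (leq_pexp2l b0 jl2))// (leq_trans _ (leq_mul hb hb)).
(* The upper bound with [l = 1], whose condition is vacuous, supplies the boundedness of the
   supremum. *)
apply: (@osc_ge _ _ _ _ _ (2 / (1 - q) * q ^+ 1)).
- by move=> x' h' _ _; apply: Delta2_levy_le => // i /andP[]; case: i.
- by rewrite /in3lambda x1/=; lra.
- by rewrite /in3lambda; lra.
Qed.

End LevyOscillation.

(** * Levels of grid intervals, their existence and their counting *)

Lemma near_multiple_shift (q : nat) (K Y : int) :
  (q %| Y)%Z -> near_multiple q (K + Y) = near_multiple q K.
Proof.
by move=> qY; rewrite /near_multiple ![K + Y + _]addrAC !(rpredDr _ qY).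
Qed.

Lemma near_multiple_dvd (p q : nat) (K : int) :
  (p %| q)%N -> near_multiple q K -> near_multiple p K.
Proof.
move=> pq; have tr m : (q %| m)%Z -> (p %| m)%Z by apply: dvdz_trans.
by case/or3P => /tr h; apply/or3P; [apply: Or31|apply: Or32|apply: Or33].
Qed.

(* Truncating the level from below at [J] makes it insensitive to shifts by multiples of [b^-J]. *)
Definition is_level (b J j l : nat) (k : int) : Prop :=
  [/\ (J <= l)%N, (l <= j)%N, near_multiple (b ^ (j - l)) k &
      forall i, (J <= i < l)%N -> ~~ near_multiple (b ^ (j - i)) k].

Lemma exists_level (b J j : nat) (k : int) :
  (J <= j)%N -> exists l, is_level b J j l k.
Proof.
move=> Jj.
have ex : exists l, [&& (J <= l)%N, (l <= j)%N & near_multiple (b ^ (j - l)) k].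
  (* At [l = j] the modulus is 1, so the search always succeeds. *)
  exists j; rewrite Jj leqnn subnn expn0 /=.
  by apply/or3P; apply: Or31; rewrite dvdzE dvd1n.
case: (ex_minnP ex) => l /and3P[Jl lj nl] hmin; exists l; split => // i.
move=> /andP[Ji il]; apply/negP => ni.
by have := hmin i; rewrite Ji ni (ltnW (leq_trans il lj)) leqNgt il => /(_ isT).
Qed.

(** The quotient by [q] is injective on a residue class and takes fewer than [m + 1] values. *)
Lemma card_dvdz_shift (N m q : nat) (c : int) : (0 < q)%N -> N = (m * q)%N ->
  (#|[pred k : 'I_N | (q %| (k%:Z + c)%R)%Z]| <= m)%N.
Proof.
move=> q0 Nmq.
have div_lt (k : 'I_N) : (k %/ q < m)%N by rewrite ltn_divLR// -Nmq.
rewrite -[leqRHS]card_ord.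
apply: (leq_card_in (fun k => Ordinal (div_lt k))) => k1 k2.
rewrite !inE => h1 h2 [e]; apply: val_inj => /=.
rewrite (divn_eq k1 q) (divn_eq k2 q) e; congr (_ + _)%N.
have : (q%:Z %| k1%:Z - k2%:Z)%Z.
  by have := rpredB h1 h2; congr (_ %| _)%Z; ring.
by rewrite -eqz_mod_dvd !modz_nat => /eqP[].
Qed.

Lemma card_near_multiple (N m q : nat) : (0 < q)%N -> N = (m * q)%N ->
  (#|[pred k : 'I_N | near_multiple q k%:Z]| <= 3 * m)%N.
Proof.
move=> q0 Nmq.
pose A c := [pred k : 'I_N | (q %| (k%:Z + c)%R)%Z].
have h c : (#|A c| <= m)%N by exact: card_dvdz_shift.
have hU (P Q : simpl_pred 'I_N) : (#|[predU P & Q]| <= #|P| + #|Q|)%N.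
  by rewrite -cardUI leq_addr.
apply: (@leq_trans #|[predU A (- 1)%R & [predU A 0%R & A 1%R]]|).
  by apply/subset_leq_card/fintype.subsetP => k; rewrite !inE addr0.
apply: (leq_trans (hU _ _)); rewrite 2!mulSn mul1n leq_add//.
by apply: (leq_trans (hU _ _)); rewrite leq_add.
Qed.

(** A shift by [Y b^-J] moves the grid index by a multiple of [b^(j-J)], which leaves the level
    unchanged; the constant [E] serves all intervals at once. *)
Lemma ln_osc_levy (R : realType) (b : nat) (alpha : R) (J : nat) (Y : int) :
  (2 <= b)%N -> 0 < alpha -> (0 < J)%N ->
  exists E : R, forall (j l : nat) (k : int), is_level b J j l k ->
    let o := osc b (shifted_levy b alpha (- (Y%:~R / b%:R ^+ J))) j k in
    0 < o /\ `|ln o + alpha * l%:R * ln b%:R| <= E.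
Proof.
move=> hb alpha0 J0; have b0 : (0 < b)%N by exact: ltnW.
have bR : 0 < b%:R :> R by rewrite ltr0n.
pose q : R := powR b%:R (- alpha).
have q0 : 0 < q by exact: powRN_base_gt0.
have q1 : q < 1 by exact: powRN_base_lt1.
(* The factor [q^-J] pays for level [J], where nothing is known about smaller indices and only the
   trivial bound is available. *)
pose C := 2 / (1 - q) * q ^- J.
have C0 : 0 < C by rewrite mulr_gt0 ?divr_gt0 ?invr_gt0 ?exprn_gt0// subr_gt0.
exists (`|ln C| + `|ln (2^-1 : R)|) => j l k [Jl lj nl hmin] o.
have Jj := leq_trans Jl lj.
pose Z : int := Y * (b ^ (j - J))%:Z.
have nearE i : (J <= i)%N ->
    near_multiple (b ^ (j - i)) (k + Z) = near_multiple (b ^ (j - i)) k.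
  move=> Ji; apply: near_multiple_shift; apply: dvdz_mull.
  by rewrite dvdzE/= dvdn_exp2l// leq_sub2l.
have oE : o = osc b (levy b alpha) j (k + Z).
  rewrite /o -osc_shift//; congr osc; apply/funext => x.
  rewrite /shifted_levy opprK; congr (levy b alpha (x + _)).
  rewrite /Z intrM -[_%:Z%:~R]/((b ^ (j - J))%:R) natrX -mulrA; congr (_ * _).
  have -> : b%:R ^+ j = b%:R ^+ (j - J) * b%:R ^+ J :> R by rewrite -exprD subnK.
  by rewrite invfM mulrA divff ?mul1r// expf_neq0// gt_eqF.
have lo : 2^-1 * q ^+ l <= o.
  by rewrite oE osc_levy_ge ?(leq_trans J0)// nearE.
have up : o <= C * q ^+ l.
  have D0 : 0 <= 2 / (1 - q) by rewrite divr_ge0// subr_ge0 ltW.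
  have qJ : 0 < q ^+ J by rewrite exprn_gt0.
  have [e|nJl] := eqVneq l J.
    rewrite e /C mulfVK ?gt_eqF// oE.
    apply: (le_trans (@osc_levy_le _ _ _ hb alpha0 j 1 _ isT (leq_trans J0 Jj) _)).
      by case.
    by rewrite -/q -[leRHS]mulr1 ler_wpM2l// expr1 ltW.
  have Jl' : (J < l)%N by rewrite ltn_neqAle eq_sym nJl.
  apply: (@le_trans _ _ (2 / (1 - q) * q ^+ l)).
    rewrite oE osc_levy_le ?(leq_trans J0)// => i /andP[i0 il].
    have [Ji|iJ] := leqP J i; first by rewrite nearE// hmin// Ji.
    (* Below [J] the shift may matter, but [b^(j-J)] divides [b^(j-i)], so a jump at index [i] would
       force one at [J]. *)
    have := hmin J; rewrite leqnn Jl' => /(_ isT); rewrite -(nearE J)//.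
    by apply: contra; apply: near_multiple_dvd; rewrite dvdn_exp2l// leq_sub2l// ltnW.
  rewrite /C -[leRHS]mulrA ler_wpM2l// ler_peMl ?exprn_ge0 ?(ltW q0)//.
  by rewrite invf_ge1// exprn_ile1// ltW.
have ql : 0 < q ^+ l by rewrite exprn_gt0.
have o0 : 0 < o by rewrite (lt_le_trans _ lo)// mulr_gt0.
split=> //.
have lnq : ln (q ^+ l) = - (alpha * l%:R * ln b%:R).
  by rewrite lnXn// /q ln_powR -mulr_natl; ring.
have l1 : ln (2^-1 : R) + ln (q ^+ l) <= ln o.
  by rewrite -lnM ?posrE// ler_ln ?posrE// mulr_gt0.
have l2 : ln o <= ln C + ln (q ^+ l).
  by rewrite -lnM ?posrE// ler_ln ?posrE// mulr_gt0.
move: l1 l2; rewrite lnq.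
have := ler_norm (ln C); have := ler_norm (- ln (2^-1 : R)); rewrite normrN.
have := normr_ge0 (ln C); have := normr_ge0 (ln (2^-1 : R)).
by rewrite ler_norml => *; apply/andP; split; lra.
Qed.

(** All factors have the same level [l], so the logarithms add up to [-s l ln b]; as [r i] may be
    negative, the errors are weighted by [|r i|]. *)
Lemma prod_powR_osc_bounds (R : realType) (b n J : nat) (alpha r : 'I_n -> R)
    (Y : 'I_n -> int) :
  (2 <= b)%N -> (forall i, 0 < alpha i) -> (0 < J)%N ->
  exists E : R, forall (j l : nat) (k : int), is_level b J j l k ->
    let P := \prod_(i < n) powR (osc b (shifted_levy b (alpha i)
               (- ((Y i)%:~R / b%:R ^+ J))) j k) (r i) in
    let s := \sum_(i < n) alpha i * r i in
    expR (- E - s * l%:R * ln b%:R) <= P <= expR (E - s * l%:R * ln b%:R).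
Proof.
move=> hb alpha0 J0.
have /choice[E hE] := fun i => ln_osc_levy R b (alpha i) J (Y i) hb (alpha0 i) J0.
exists (\sum_(i < n) `|r i| * E i) => j l k lev /=.
pose o i := osc b (shifted_levy b (alpha i) (- ((Y i)%:~R / b%:R ^+ J))) j k.
set s := \sum_(i < n) alpha i * r i.
rewrite [X in _ <= X <= _](_ : _ = expR (\sum_(i < n) r i * ln (o i))); last first.
  rewrite expR_sum; apply: eq_bigr => i _.
  by rewrite /powR gt_eqF//; have [] := hE i j l k lev.
rewrite !ler_expR.
have : `|\sum_(i < n) r i * ln (o i) + s * l%:R * ln b%:R| <=
    \sum_(i < n) `|r i| * E i.
  rewrite -mulrA /s mulr_suml -big_split/=.
  apply: (le_trans (ler_norm_sum _ _ _)); apply: ler_sum => i _.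
  rewrite [alpha i * _]mulrC -mulrA -mulrDr normrM ler_wpM2l// mulrA.
  by have [] := hE i j l k lev.
by rewrite ler_norml => /andP[h1 h2]; apply/andP; split; lra.
Qed.

(** * Size of the structure function, from the level of each interval *)

Section LevelSum.
Context (R : realType) (b J : nat) (E s : R) (T : nat -> nat -> R).
Hypotheses (hb : (2 <= b)%N).
Let L : R := ln b%:R.
Hypothesis hT : forall j l k : nat, is_level b J j l k%:Z ->
  expR (- E - s * l%:R * L) <= T j k <= expR (E - s * l%:R * L).

Let S (j : nat) : R := b%:R ^- j * \sum_(k < b ^ j) T j k.

Let bR : 0 < b%:R :> R. Proof. by rewrite ltr0n ltnW. Qed.

Let b0 : (0 < b)%N. Proof. exact: ltnW. Qed.

Let L0 : 0 < L. Proof. by rewrite ln_gt0// ltr1n. Qed.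

Let expr_base (j : nat) : b%:R ^+ j = expR (j%:R * L) :> R.
Proof. by rewrite expRM_natl lnK. Qed.

Let T_gt0 (j k : nat) : (J <= j)%N -> 0 < T j k.
Proof.
move=> Jj; have [l lev] := exists_level b J j k%:Z Jj.
by have /andP[+ _] := hT _ _ _ lev; apply: lt_le_trans; exact: expR_gt0.
Qed.

Lemma level_sum_le (j : nat) : (J <= j)%N ->
  S j <= (1 + j%:R) * (3 * expR (E - j%:R * Num.min 1 s * L)).
Proof.
move=> Jj.
pose N l := fun k : 'I_(b ^ j) => near_multiple (b ^ (j - l)) k%:Z.
(* Allowing every [l] with a jump, not just the level of [k], only adds nonnegative terms and turns
   the sum over [k] into a count. *)
have hTk (k : 'I_(b ^ j)) :
    T j k <= \sum_(l < j.+1) (if N l k then expR (E - s * l%:R * L) else 0).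
  have [l lev] := exists_level b J j k%:Z Jj.
  have /andP[_ hl] := hT _ _ _ lev; case: lev => [_ lj nl _].
  apply: (le_trans hl); have lj1 : (l < j.+1)%N by [].
  rewrite (bigD1 (Ordinal lj1))//= /N nl lerDl sumr_ge0// => i _.
  by case: ifP => // _; exact: expR_ge0.
apply: (@le_trans _ _ (b%:R ^- j * \sum_(k < b ^ j)
    \sum_(l < j.+1) (if N l k then expR (E - s * l%:R * L) else 0))).
  by rewrite ler_wpM2l ?invr_ge0 ?exprn_ge0 ?(ltW bR)// ler_sum.
rewrite exchange_big/= mulr_sumr.
apply: (@le_trans _ _ (\sum_(l < j.+1) 3 * expR (E - j%:R * Num.min 1 s * L)));
  last by rewrite sumr_const card_ord -[leLHS]mulr_natl [1 + _]addrC natr1.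
apply: ler_sum => l _; rewrite -big_mkcond/= sumr_const.
have lj : (l <= j)%N by rewrite -ltnS.
have card : (#|[pred k | N l k]| <= 3 * b ^ l)%N.
  by apply: card_near_multiple; rewrite ?expn_gt0 ?b0// -expnD subnKC.
apply: (@le_trans _ _ (b%:R ^- j * (expR (E - s * l%:R * L) * (3 * b ^ l)%:R))).
  rewrite ler_wpM2l ?invr_ge0 ?exprn_ge0 ?(ltW bR)// -[leLHS]mulr_natr ler_wpM2l // ?expR_ge0 //.
  by rewrite ler_nat.
rewrite natrM natrX !expr_base -expRN mulrCA [_ * (3 * _)]mulrCA mulrCA.
rewrite ler_wpM2l// mulrCA -!expRD ler_expR.
have lR : l%:R <= j%:R :> R by rewrite ler_nat.
have l0 : 0 <= l%:R :> R by [].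
(* The exponent is affine in [l], so on [0 <= l <= j] it is largest at [l = 0] or [l = j], which
   yields the exponents 1 and [s]. *)
suff : (l%:R - s * l%:R - j%:R) * L <= - (j%:R * Num.min 1 s) * L by lra.
rewrite ler_wpM2r ?(ltW L0)//.
by have [s1|s1] := leP 1 s; nra.
Qed.

(** The single interval [k = 0] has the lowest level [J] and contributes a constant times [b^-j]. *)
Lemma level_sum_ge1 : exists c : R, forall j : nat, (J <= j)%N ->
  expR (c - j%:R * L) <= S j.
Proof.
exists (- E - s * J%:R * L) => j Jj.
have bj0 : (0 < b ^ j)%N by rewrite expn_gt0 b0.
have lev : is_level b J j J 0%:Z.
  split => //; first by rewrite /near_multiple dvdz0 orbT.
  by move=> i; rewrite ltnNge andbN.
have /andP[h _] := hT _ _ _ lev.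
rewrite expRD expRN -expr_base mulrC ler_pM2l ?invr_gt0 ?exprn_gt0//.
apply: (le_trans h); rewrite (bigD1 (Ordinal bj0))//= lerDl sumr_ge0// => i _.
exact/ltW/T_gt0.
Qed.

(** At least a quarter of the intervals have level [j - 1] or [j]; [ln 4] accounts for that
    proportion and [|s| L] for the one level of slack. *)
Lemma level_sum_ge2 : exists c : R, forall j : nat, (J + 2 <= j)%N ->
  expR (c - j%:R * s * L) <= S j.
Proof.
exists (- E - `|s| * L - ln 4) => j Jj.
have Jj0 : (J <= j)%N by lia.
have Jj2 : (J <= j - 2)%N by lia.
have j2 : (2 <= j)%N by lia.
(* The modulus is [b^2] because [3/b^2 <= 3/4] for every [b >= 2], while [3/b] need not be below
   1. *)
pose N := [pred k : 'I_(b ^ j) | near_multiple (b ^ 2) k%:Z].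
have hTk (k : 'I_(b ^ j)) : k \in predC N ->
    expR (- E - `|s| * L - s * j%:R * L) <= T j k.
  rewrite !inE => nk; have [l lev] := exists_level b J j k%:Z Jj0.
  have /andP[hl _] := hT _ _ _ lev; case: lev => [_ lj nl _].
  apply: le_trans hl; rewrite ler_expR.
  have l2 : (j <= l + 1)%N.
    rewrite leqNgt; apply: contra nk => lj'.
    apply: near_multiple_dvd nl; rewrite dvdn_exp2l//.
    by move: lj' lj j2; clear; lia.
  have h1 : l%:R <= j%:R :> R by rewrite ler_nat.
  have h2 : j%:R <= l%:R + 1 :> R by rewrite natr1 ler_nat -addn1.
  have := ler_norm s; have := ler_norm (- s); rewrite normrN => h3 h4.
  suff : (- `|s| - s * j%:R) * L <= (- s * l%:R) * L by lra.
  by rewrite ler_wpM2r ?(ltW L0)//; nra.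
have aux (x y m B : nat) :
    (x + y = B -> x <= 3 * m -> m * 4 <= B -> B <= 4 * y)%N by lia.
have card : (b ^ j <= 4 * #|predC N|)%N.
  have e : (b ^ j = b ^ (j - 2) * b ^ 2)%N by rewrite -expnD subnK.
  have cN : (#|N| <= 3 * b ^ (j - 2))%N.
    by apply: card_near_multiple; rewrite ?expn_gt0 ?b0.
  have eC : (#|N| + #|predC N| = b ^ j)%N by rewrite cardC card_ord.
  have b4 : (4 <= b ^ 2)%N by rewrite (leq_mul hb hb).
  have : (b ^ (j - 2) * 4 <= b ^ j)%N by rewrite e leq_mul2l b4 orbT.
  exact: (aux _ _ _ _ eC cN).
apply: (@le_trans _ _ (b%:R ^- j * \sum_(k in predC N) T j k)); last first.
  rewrite ler_wpM2l ?invr_ge0 ?exprn_ge0 ?(ltW bR)//.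
  rewrite [leRHS](bigID (mem (predC N)))/= lerDl sumr_ge0// => i _.
  exact/ltW/T_gt0.
apply: (@le_trans _ _ (b%:R ^- j *
    \sum_(k in predC N) expR (- E - `|s| * L - s * j%:R * L))); last first.
  by rewrite ler_wpM2l ?invr_ge0 ?exprn_ge0 ?(ltW bR)// ler_sum.
rewrite sumr_const -[X in _ <= _ * X]mulr_natr [leRHS]mulrCA.
have -> : - E - `|s| * L - ln 4 - j%:R * s * L =
  (- E - `|s| * L - s * j%:R * L) - ln 4 by ring.
rewrite expRD ler_pM2l ?expR_gt0// expRN lnK ?posrE//.
rewrite [leRHS]mulrC ler_pdivlMr ?exprn_gt0// mulrC ler_pdivrMr// mulrC.
by rewrite -natrX -natrM ler_nat.
Qed.

End LevelSum.

(** * From the estimates to the scaling function *)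

Lemma ln_nat_le_eps (R : realType) (C eps : R) : 0 < eps ->
  \forall j \near \oo%classic, C + ln (1 + j%:R) <= eps * j%:R.
Proof.
move=> e0; have e20 : 0 < eps / 2 by rewrite divr_gt0.
near=> j.
have hj : (C + eps / 2 - ln (eps / 2)) / (eps / 2) <= j%:R.
  by near: j; exact: nbhs_infty_ger.
have j0 : 0 < 1 + j%:R :> R by rewrite ltr_pwDl.
have : ln (eps / 2 * (1 + j%:R)) < eps / 2 * (1 + j%:R).
  by rewrite ln_sublinear// mulr_gt0.
rewrite lnM ?posrE//; move: hj; rewrite ler_pdivrMr//; lra.
Unshelve. all: by end_near. Qed.

(** The two lower bounds together give the exponent [min 1 s], matching the upper bound up to an
    error [C + ln (1 + j)], negligible against [j]. *)
Lemma cvg_ln_ratio (R : realType) (b J : nat) (S : nat -> R) (s c1 c2 E : R) :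
  (2 <= b)%N ->
  (forall j, (J <= j)%N -> expR (c1 - j%:R * ln b%:R) <= S j) ->
  (forall j, (J <= j)%N -> expR (c2 - j%:R * s * ln b%:R) <= S j) ->
  (forall j, (J <= j)%N ->
    S j <= (1 + j%:R) * (3 * expR (E - j%:R * Num.min 1 s * ln b%:R))) ->
  ((fun j => ln (S j) / ln (b%:R ^- j)) @ \oo --> Num.min 1 s)%classic.
Proof.
move=> hb h1 h2 hE; set m := Num.min 1 s; pose L : R := ln b%:R.
have bR : 0 < b%:R :> R by rewrite ltr0n ltnW.
have L0 : 0 < L by rewrite ln_gt0// ltr1n.
pose C : R := `|c1| + `|c2| + `|E| + ln 3.
have ln3 : 0 <= ln 3 :> R by rewrite ln_ge0// ler1n.
apply/cvgrPdist_le => eps e0; near=> j.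
have Jj : (J <= j)%N by near: j; exact: nbhs_infty_ge.
have j0 : 0 < j%:R :> R by rewrite ltr0n; near: j; exact: nbhs_infty_gt.
have hj : C + ln (1 + j%:R) <= eps * L * j%:R.
  by near: j; apply: ln_nat_le_eps; rewrite mulr_gt0.
have S0 : 0 < S j by rewrite (lt_le_trans _ (h1 j Jj))// expR_gt0.
have j1 : 0 < 1 + j%:R :> R by rewrite ltr_pwDl.
have l1 : c1 - j%:R * L <= ln (S j) by rewrite -ler_expR lnK ?posrE// h1.
have l2 : c2 - j%:R * s * L <= ln (S j) by rewrite -ler_expR lnK ?posrE// h2.
have l3 : ln (S j) <= ln (1 + j%:R) + (ln 3 + (E - j%:R * m * L)).
  rewrite -[X in ln 3 + X]expRK -lnM ?posrE ?expR_gt0//.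
  by rewrite -lnM ?posrE ?mulr_gt0 ?expR_gt0// ler_ln ?posrE ?hE ?mulr_gt0 ?expR_gt0.
have l4 : - C - j%:R * m * L <= ln (S j).
  have := ler_norm (- c1); have := ler_norm (- c2); rewrite !normrN.
  have := normr_ge0 c1; have := normr_ge0 c2; have := normr_ge0 E.
  move: l1 l2; rewrite /m /C; case: (leP 1 s) => _ *; lra.
have ln1 : 0 <= ln (1 + j%:R) :> R by rewrite ln_ge0// lerDl ltW.
have -> : ln (b%:R ^- j) = - (j%:R * L) :> R.
  by rewrite lnV ?posrE ?exprn_gt0// lnXn// mulr_natl.
have jL : 0 < j%:R * L by rewrite mulr_gt0.
rewrite invrN mulrN opprK -[m](mulfK (lt0r_neq0 jL)) -mulrDl normrM.
rewrite [`|_^-1|]gtr0_norm ?invr_gt0// ler_pdivrMr// ler_norml.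
have := ler_norm E; have := normr_ge0 c1; have := normr_ge0 c2.
by move: hj; rewrite /C in l4 *; move=> *; apply/andP; split; lra.
Unshelve. all: by end_near. Qed.

Lemma scaling_fun_levy (R : realType) (b n J : nat) (alpha r : 'I_n -> R)
    (Y : 'I_n -> int) :
  (2 <= b)%N -> (forall i, 0 < alpha i) -> (0 < J)%N ->
  scaling_fun b (fun i => shifted_levy b (alpha i) (- ((Y i)%:~R / b%:R ^+ J))) r
  = (Num.min 1 (\sum_(i < n) alpha i * r i))%:E.
Proof.
move=> hb alpha0 J0; set s := \sum_(i < n) _.
have [E hE] := prod_powR_osc_bounds R b n J alpha r Y hb alpha0 J0.
pose T j k := \prod_(i < n) powR (osc b (shifted_levy b (alpha i)
               (- ((Y i)%:~R / b%:R ^+ J))) j k%:Z) (r i).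
have hT j l k : is_level b J j l k%:Z ->
    expR (- E - s * l%:R * ln b%:R) <= T j k <= expR (E - s * l%:R * ln b%:R).
  by move=> lev; exact: hE.
have [c1 h1] := level_sum_ge1 R b J E s T hb hT.
have [c2 h2] := level_sum_ge2 R b J E s T hb hT.
rewrite /scaling_fun; apply: (cvg_limn_einf_sup _).1.
apply: cvg_EFin; first by near=> j.
apply: (@cvg_ln_ratio _ _ (J + 2)%N _ s c1 c2 E hb) => j Jj.
- by apply: h1; rewrite (leq_trans _ Jj)// leq_addr.
- exact: h2.
- by apply: (@level_sum_le _ _ J _ _ T hb hT); rewrite (leq_trans _ Jj)// leq_addr.
Unshelve. all: by end_near. Qed.

(** * The Legendre transform and the conclusion *)

Lemma ereal_inf_eqNy (R : realType) (A : set (\bar R)) :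
  (forall M : R, exists2 x, A x & (x <= M%:E)%E) -> ereal_inf A = -oo%E.
Proof.
move=> hA; have h M : (ereal_inf A <= M%:E)%E by exact: ge_ereal_inf.
case: (ereal_inf A) h => [z h|h|//].
  by have := h (z - 1)%R; rewrite lee_fin => hz; exfalso; lra.
by have := h 0%R.
Qed.

Lemma common_badic_denominator (R : realType) (b n : nat) (y : 'I_n -> R) :
  (0 < b)%N -> (forall i, badic_in01 b (y i)) ->
  exists J (Y : 'I_n -> int), (0 < J)%N /\ forall i, y i = (Y i)%:~R / b%:R ^+ J.
Proof.
move=> b0 /choice[d /choice[k hk]].
(* The sum dominates every exponent, and the successor makes [J] positive. *)
pose J := (\sum_(i < n) d i).+1; exists J, (fun i => (k i * b ^ (J - d i))%:Z).
split => // i; have dJ : (d i <= J)%N by rewrite leqW// (bigD1 i)//= leq_addr.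
have bn : b%:R != 0 :> R by rewrite pnatr_eq0 -lt0n.
have [-> _] := hk i; rewrite -[_%:Z%:~R]/((_ * _)%:R) natrM natrX.
have -> : b%:R ^+ J = b%:R ^+ (J - d i) * b%:R ^+ d i :> R by rewrite -exprD subnK.
by rewrite invfM -mulrA (mulrA (_ ^+ _)) divff ?mul1r// expf_neq0.
Qed.

Lemma sum_mul_indicator (R : realType) (n : nat) (a : 'I_n -> R) (i : 'I_n) (x : R) :
  \sum_(k < n) a k * (x * (k == i)%:R) = a i * x.
Proof.
rewrite (bigD1 i)//= eqxx mulr1 big1 ?addr0// => k /negbTE ->.
by rewrite !mulr0.
Qed.

(** If [H] is not proportional to [alpha], some [r] orthogonal to [alpha] drives the value to [-oo].
    If [H = t alpha], only [s = alpha . r] matters, and [1 - min 1 s + t s] is bounded below exactly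
    when [0 <= t <= 1]. *)
Lemma ereal_inf_legendre (R : realType) (n : nat) (alpha H : 'I_n -> R) (i0 : 'I_n)
    (F : ('I_n -> R) -> \bar R) :
  (forall i, 0 < alpha i) ->
  (forall r, F r = (1 - Num.min 1 (\sum_(i < n) alpha i * r i)
                      + \sum_(i < n) H i * r i)%:E) ->
  ereal_inf [set F r | r in [set: 'I_n -> R]]%classic =
  if [forall i, 0 <= H i <= alpha i]
     && [forall i, (i != i0) ==> (H i == alpha i / alpha i0 * H i0)]
   then (H i0 / alpha i0)%:E
   else -oo%E.
Proof.
move=> alpha0 hF; have a0 := alpha0 i0; have a00 := lt0r_neq0 a0.
set t := H i0 / alpha i0.
have H0 : H i0 = t * alpha i0 by rewrite /t mulfVK.
have Fline x : F (fun k => x / alpha i0 * (k == i0)%:R) = (1 - Num.min 1 x + t * x)%:E.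
  rewrite hF !sum_mul_indicator mulrCA divff// mulr1; congr (_ + _)%:E.
  by rewrite /t mulrCA mulrC.
have [prop|/forallPn[i]] := boolP [forall i,
    (i != i0) ==> (H i == alpha i / alpha i0 * H i0)]; last first.
  rewrite negb_imply andbF /= => /andP[ni0 nH].
  pose D := H i - alpha i / alpha i0 * H i0.
  have D0 : D != 0 by rewrite subr_eq0.
  apply: ereal_inf_eqNy => M; pose x := (M - 1) / D.
  (* This [r] is orthogonal to [alpha], and [x] is chosen so that [H . r = M - 1]. *)
  pose r k := x * (k == i)%:R + (- (x * alpha i / alpha i0)) * (k == i0)%:R.
  exists (F r); first by exists r.
  have sumE a : \sum_(k < n) a k * r k =
      a i * x + a i0 * (- (x * alpha i / alpha i0)).
    by under eq_bigr do rewrite mulrDr; rewrite big_split/= !sum_mul_indicator.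
  rewrite hF !sumE lee_fin.
  have -> : alpha i * x + alpha i0 * - (x * alpha i / alpha i0) = 0 by field.
  have -> : H i * x + H i0 * - (x * alpha i / alpha i0) = x * D.
    by rewrite /D; field.
  by rewrite /x mulfVK// min_r//; lra.
rewrite andbT.
have hH i : H i = t * alpha i.
  have [->//|ni] := eqVneq i i0.
  by have /forallP/(_ i) := prop; rewrite ni => /eqP ->; rewrite /t; field.
have sumH r : \sum_(i < n) H i * r i = t * \sum_(i < n) alpha i * r i.
  by rewrite mulr_sumr; apply: eq_bigr => i _; rewrite hH mulrA.
have -> : [forall i, 0 <= H i <= alpha i] = (0 <= t <= 1).
  apply/forallP/idP => [/(_ i0)|/andP[t0 t1] i].
    by rewrite H0 pmulr_lge0// ger_pMl.
  by rewrite hH pmulr_lge0// ger_pMl// t0.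
have [/andP[t0 t1]|nt] := boolP (0 <= t <= 1).
  apply/eqP; rewrite eq_le; apply/andP; split.
    (* The minimum [t] is attained at [s = 1], the kink of [min 1 s]. *)
    apply: ge_ereal_inf; exists (F (fun k => 1 / alpha i0 * (k == i0)%:R)).
      by eexists.
    by rewrite (Fline 1) lee_fin minxx; lra.
  apply: le_ereal_inf_tmp => _ [r _ <-]; rewrite hF sumH lee_fin.
  by case: (leP 1 (\sum_(i < n) alpha i * r i)) => hs; nra.
apply: ereal_inf_eqNy => M.
suff [x hx] : exists x, 1 - Num.min 1 x + t * x <= M.
  exists (F (fun k => x / alpha i0 * (k == i0)%:R)); first by eexists.
  by rewrite Fline lee_fin.
have [t0|t0] := ltP t 0.
  (* For [t < 0] the value is [t s] once [s >= 1], so [s] is taken large. *)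
  exists (Num.max 1 (M / t)); rewrite min_l ?le_max ?lexx//.
  suff : t * Num.max 1 (M / t) <= M by lra.
  by rewrite mulrC -ler_ndivrMr// le_max lexx orbT.
have t1 : 0 < t - 1 by rewrite subr_gt0 ltNge; apply: contra nt => ->; rewrite t0.
(* For [t > 1] the value is [1 + (t - 1) s] once [s <= 1], so [s] is taken very negative if need
   be. *)
exists (Num.min 1 ((M - 1) / (t - 1))); rewrite (@min_r _ _ 1) ?ge_min ?lexx//.
suff : (t - 1) * Num.min 1 ((M - 1) / (t - 1)) <= M - 1 by lra.
by rewrite mulrC -ler_pdivlMr// ge_min lexx orbT.
Qed.

Theorem mainTheorem2 (R : realType) (b n : nat) (hb : (2 <= b)%N) (hn : (2 <= n)%N)
  (alpha y : 'I_n -> R) (i0 : 'I_n) (hi0 : nat_of_ord i0 = 0%N)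
  (halpha : forall i, 0 < alpha i)
  (hy0 : y i0 = 0)
  (hy : forall i : 'I_n, i != i0 -> badic_in01 b (y i))
  (H : 'I_n -> R) :
  legendre_spectrum b (fun i : 'I_n => shifted_levy b (alpha i) (- y i)) H =
  if [forall i, 0 <= H i <= alpha i]
     && [forall i, (i != i0) ==> (H i == alpha i / alpha i0 * H i0)]
   then (H i0 / alpha i0)%:E
   else (-oo)%E.
Proof.
have hy' i : badic_in01 b (y i).
  have [->|/hy//] := eqVneq i i0.
  by exists 0%N, 0%N; rewrite hy0 mul0r lexx ltr01.
have [J [Y [J0 yE]]] := common_badic_denominator R b n y (ltnW hb) hy'.
apply: ereal_inf_legendre => // r.
have -> : (fun i => shifted_levy b (alpha i) (- y i)) =
    (fun i => shifted_levy b (alpha i) (- ((Y i)%:~R / b%:R ^+ J))).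
  by apply/funext => i; rewrite yE.
by rewrite scaling_fun_levy.
Qed.
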